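(* Let $g$ be a positive integer and let $E\subset M(\mathbb{C})^g$ be a nonempty subset that is closed with respect to direct sums. Then $E$ is compact in the free topology if and only if there exists $X\in E$ such that $E$ is contained in the polynomial dilation hull of $X$ (that is, every $Y\in E$ polynomially dilates to an ampliation $I_k\otimes X$ of $X$ for some positive integer $k$, which may depend on $Y$).
   Context: For positive integers $n,g$, $M_n(\mathbb{C})^g$ is the set of $g$-tuples of $n\times n$ complex matrices, and $M(\mathbb{C})^g$ is the sequence $(M_n(\mathbb{C})^g)_{n\ge 1}$ (equivalently, the disjoint union over $n$). A subset $E\subset M(\mathbb{C})^g$ is a sequence $(E(n))_{n}$ with $E(n)\subset M_n(\mathbb{C})^g$; $X\in E$ means $X\in E(n)$ for some $n$; inclusions and unions are taken levelwise. $E$ is closed with respect to direct sums if $X\in E(n)$ and $Y\in E(m)$ imply $X\oplus Y=\left(\begin{pmatrix}X_1&0\\0&Y_1\end{pmatrix},\dots,\begin{pmatrix}X_g&0\\0&Y_g\end{pmatrix}\right)\in E(n+m)$. A (scalar) free polynomial is an element $p=\sum_w p_w w$ (finite sum, $p_w\in\mathbb{C}$, $w$ words) of the free unital algebra over $\mathbb{C}$ on $g$ noncommuting variables $x_1,\dots,x_g$, evaluated at $X\in M_n(\mathbb{C})^g$ by $p(X)=\sum_w p_w w(X)$, where the empty word evaluates to $I_n$. A matrix-valued free polynomial is a matrix, of any finite size, whose entries are free polynomials; written $\delta=\sum_w \delta_w w$ with matrix coefficients $\delta_w$, it is evaluated by $\delta(X)=\sum_w \delta_w\otimes w(X)$.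 The norm $\|\cdot\|$ is the operator norm. The free topology on $M(\mathbb{C})^g$ has as a basis the sets $G_\delta=(G_\delta(n))_n$, $G_\delta(n)=\{X\in M_n(\mathbb{C})^g:\|\delta(X)\|<1\}$, where $\delta$ ranges over all matrix-valued free polynomials. Compact means every open cover has a finite subcover. A tuple $Y\in M_n(\mathbb{C})^g$ polynomially dilates to $X\in M_N(\mathbb{C})^g$ if there is an isometry $V:\mathbb{C}^n\to\mathbb{C}^N$ such that $p(Y)=V^*p(X)V$ for all free polynomials $p$. An ampliation of $X$ is a tuple $I_k\otimes X=(I_k\otimes X_1,\dots,I_k\otimes X_g)$ for a positive integer $k$. The polynomial dilation hull of $X$ is the set of all $Y\in M(\mathbb{C})^g$ that polynomially dilate to an ampliation of $X$. *)

(* Defs.v *)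
From HB Require Import structures.
From mathcomp Require Import all_boot all_order all_algebra.
From mathcomp Require Import finmap sesquilinear spectral.
From mathcomp Require Import complex mxtens monalg.
From mathcomp Require Import all_classical all_reals topology.

Set Implicit Arguments.
Unset Strict Implicit.
Unset Printing Implicit Defensive.

Import Order.TTheory GRing.Theory Num.Theory.

Local Open Scope classical_set_scope.
Local Open Scope ring_scope.

Section OperatorNorm.
Variable R : realType.

Definition enorm n (v : 'cV[R[i]]_n) : R :=
  Num.sqrt (\sum_i ComplexField.Normc.normc (v i 0) ^+ 2).

Definition opnorm m n (A : 'M[R[i]]_(m, n)) : R :=
  sup [set enorm (A *m v) | v in [set v : 'cV_n | enorm v <= 1]].

Definition is_isometry m n (V : 'M[R[i]]_(m, n)) : Prop :=
  forall v : 'cV_n, enorm (V *m v) = enorm v.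

Lemma enorm_ge0 n (v : 'cV[R[i]]_n) : 0 <= enorm v.
Proof. exact: sqrtr_ge0. Qed.

Lemma sqr_enorm n (v : 'cV[R[i]]_n) :
  enorm v ^+ 2 = \sum_i ComplexField.Normc.normc (v i 0) ^+ 2.
Proof. by rewrite sqr_sqrtr // sumr_ge0 // => i _; exact: sqr_ge0. Qed.

Lemma normc_ge0 (x : R[i]) : 0 <= ComplexField.Normc.normc x.
Proof. by case: x => a b; exact: sqrtr_ge0. Qed.

Lemma enormZ n (c : R[i]) (v : 'cV[R[i]]_n) :
  enorm (c *: v) = ComplexField.Normc.normc c * enorm v.
Proof.
apply/eqP; rewrite -(@eqrXn2 _ 2) ?mulr_ge0 ?enorm_ge0 ?normc_ge0 //.
rewrite exprMn !sqr_enorm mulr_sumr; apply/eqP; apply: eq_bigr => i _.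
by rewrite mxE ComplexField.Normc.normcM exprMn.
Qed.

Lemma enorm0 n : enorm (0 : 'cV[R[i]]_n) = 0.
Proof.
by rewrite -(scale0r (0 : 'cV_n)) enormZ ComplexField.Normc.normc0 mul0r.
Qed.

Lemma enorm_eq0 n (v : 'cV[R[i]]_n) : enorm v = 0 -> v = 0.
Proof.
move=> v0; have /eqP : enorm v ^+ 2 = 0 by rewrite v0 expr0n.
rewrite sqr_enorm psumr_eq0 => [/allP vi0|i _]; last exact: sqr_ge0.
apply/matrixP => i j; rewrite ord1 mxE; apply: ComplexField.Normc.eq0_normc.
by have := vi0 i (mem_index_enum _); rewrite /= sqrf_eq0 => /eqP.
Qed.

Lemma normc_le_enorm n (v : 'cV[R[i]]_n) i :
  ComplexField.Normc.normc (v i 0) <= enorm v.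
Proof.
rewrite -(@ler_pXn2r _ 2) ?nnegrE ?enorm_ge0 ?normc_ge0 //.
rewrite sqr_enorm (bigD1 i) //= lerDl sumr_ge0 // => j _; exact: sqr_ge0.
Qed.

Lemma normc_sum (I : Type) (r : seq I) (F : I -> R[i]) :
  ComplexField.Normc.normc (\sum_(i <- r) F i)
    <= \sum_(i <- r) ComplexField.Normc.normc (F i).
Proof.
elim: r => [|i r IH]; first by rewrite !big_nil ComplexField.Normc.normc0.
by rewrite !big_cons (le_trans (le_normcD _ _)) // lerD2l.
Qed.

Lemma opnorm_has_sup m n (A : 'M[R[i]]_(m, n)) :
  has_sup [set enorm (A *m v) | v in [set v : 'cV_n | enorm v <= 1]].
Proof.
split; first by exists (enorm (A *m 0)), 0; rewrite //= enorm0 ler01.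
pose s := \sum_i (\sum_j ComplexField.Normc.normc (A i j)) ^+ 2.
exists (Num.sqrt s) => _ [v /= v1 <-].
rewrite ler_wsqrtr //; apply: ler_sum => i _.
rewrite ler_pXn2r ?nnegrE ?normc_ge0 ?sumr_ge0 // => [|j _]; last exact: normc_ge0.
rewrite mxE (le_trans (normc_sum _ _)) //; apply: ler_sum => j _.
rewrite ComplexField.Normc.normcM ler_piMr ?normc_ge0 //.
exact: le_trans (normc_le_enorm _ _) v1.
Qed.

Lemma opnorm_le m n (A : 'M[R[i]]_(m, n)) c :
  (forall v : 'cV_n, enorm v <= 1 -> enorm (A *m v) <= c) -> opnorm A <= c.
Proof.
move=> Ac; apply: ge_sup; first by case: (opnorm_has_sup A).
by move=> _ [v v1 <-]; exact: Ac.
Qed.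

Lemma enorm_le_opnorm1 m n (A : 'M[R[i]]_(m, n)) (v : 'cV_n) :
  enorm v <= 1 -> enorm (A *m v) <= opnorm A.
Proof. by move=> v1; apply: ub_le_sup; [case: (opnorm_has_sup A)|exists v]. Qed.

Lemma opnorm_ge0 m n (A : 'M[R[i]]_(m, n)) : 0 <= opnorm A.
Proof.
apply: le_trans (enorm_ge0 _) (@enorm_le_opnorm1 _ _ A 0 _).
by rewrite enorm0 ler01.
Qed.

Lemma enorm_mulmx_le m n (A : 'M[R[i]]_(m, n)) (v : 'cV_n) :
  enorm (A *m v) <= opnorm A * enorm v.
Proof.
have [v0|v0] := eqVneq (enorm v) 0.
  by rewrite (enorm_eq0 v0) mulmx0 !enorm0 mulr0.
have vgt0 : 0 < enorm v by rewrite lt_def v0 enorm_ge0.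
have normV : ComplexField.Normc.normc ((enorm v)^-1)%:C%C = (enorm v)^-1.
  by rewrite /= expr0n addr0 sqrtr_sqr ger0_norm // invr_ge0 enorm_ge0.
have := @enorm_le_opnorm1 _ _ A (((enorm v)^-1)%:C%C *: v).
rewrite -scalemxAr !enormZ normV mulVf // => /(_ (lexx _)).
by rewrite ler_pdivrMl // mulrC.
Qed.

End OperatorNorm.

Section FreePolynomials.
Variables (R : realType) (g : nat).

(* the free unital algebra: finitely supported functions on words in 'I_g *)
Definition freepoly := {malg R[i][{fmonom 'I_g}]}.

Definition word_eval n (X : 'I_g -> 'M[R[i]]_n) (w : {fmonom 'I_g}) : 'M[R[i]]_n :=
  \prod_(i <- (w : seq 'I_g)) X i.

Definition poly_eval n (X : 'I_g -> 'M[R[i]]_n) (p : freepoly) : 'M[R[i]]_n :=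
  \sum_(w <- msupp p) p@_w *: word_eval X w.

(* all words w whose matrix coefficient [map_mx (mcoeff w) d] may be nonzero *)
Definition mxsupp a b (d : 'M[freepoly]_(a, b)) : {fset {fmonom 'I_g}} :=
  \big[@fsetU _/fset0%fset]_(ij : 'I_a * 'I_b) msupp (d ij.1 ij.2).

Definition mxpoly_eval a b n (X : 'I_g -> 'M[R[i]]_n) (d : 'M[freepoly]_(a, b)) :
    'M[R[i]]_(a * n, b * n) :=
  \sum_(w <- mxsupp d) map_mx (mcoeff w) d *t word_eval X w.

Definition poly_dilates n N (Y : 'I_g -> 'M[R[i]]_n) (X : 'I_g -> 'M[R[i]]_N) : Prop :=
  exists2 V : 'M[R[i]]_(N, n), is_isometry V &
    forall p : freepoly, poly_eval Y p = (V ^t*)%sesqui *m poly_eval X p *m V.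

Definition ampliation n k (X : 'I_g -> 'M[R[i]]_n) : 'I_g -> 'M[R[i]]_(k * n) :=
  fun i => 1%:M *t X i.

End FreePolynomials.

Section BlockDiagonal.
Variables (R : realType) (g : nat).

Lemma mxpoly_evalE a b n (X : 'I_g -> 'M[R[i]]_n) (d : 'M[freepoly R g]_(a, b))
    i j k l :
  mxpoly_eval X d (mxtens_index (i, k)) (mxtens_index (j, l)) =
  poly_eval X (d i j) k l.
Proof.
rewrite /mxpoly_eval /poly_eval !summxE.
have sub : (msupp (d i j) `<=` mxsupp d)%fset.
  by rewrite /mxsupp (bigD1 (i, j)) //= fsubsetUl.
rewrite (big_fset_incl _ sub) /=.
  by apply: eq_bigr => w _; rewrite tensmxE !mxE.
by move=> w _ ws; rewrite mxE mcoeff_outdom // mul0r.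
Qed.

Lemma big_mxtens (V : nmodType) m n (F : 'I_(m * n) -> V) :
  \sum_k F k = \sum_i \sum_j F (mxtens_index (i, j)).
Proof.
rewrite pair_bigA /= (reindex (@mxtens_index m n)) /=.
  by apply: eq_bigr => -[i j] _.
by exists (@mxtens_unindex m n) => ? _; rewrite ?mxtens_indexK ?mxtens_unindexK.
Qed.

Definition vtens_l b1 b2 n (v : 'cV[R[i]]_((b1 + b2) * n)) : 'cV[R[i]]_(b1 * n) :=
  \col_k v (mxtens_index (lshift b2 (mxtens_unindex k).1, (mxtens_unindex k).2)) 0.

Definition vtens_r b1 b2 n (v : 'cV[R[i]]_((b1 + b2) * n)) : 'cV[R[i]]_(b2 * n) :=
  \col_k v (mxtens_index (rshift b1 (mxtens_unindex k).1, (mxtens_unindex k).2)) 0.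

Definition vtens_pair b1 b2 n (u : 'cV[R[i]]_(b1 * n)) (v : 'cV[R[i]]_(b2 * n)) :
    'cV[R[i]]_((b1 + b2) * n) :=
  \col_(k < (b1 + b2) * n) let ij : 'I_(b1 + b2) * 'I_n := mxtens_unindex k in
    match fintype.split ij.1 with
    | inl i => u (mxtens_index (i, ij.2)) 0
    | inr i => v (mxtens_index (i, ij.2)) 0
    end.

Lemma vtens_pairl b1 b2 n (u : 'cV[R[i]]_(b1 * n)) (v : 'cV[R[i]]_(b2 * n)) :
  vtens_l (vtens_pair u v) = u.
Proof.
apply/matrixP => k j; rewrite ord1 !mxE !mxtens_indexK /= (unsplitK (inl _)).
by congr (_ _ _); rewrite -[RHS]mxtens_unindexK.
Qed.

Lemma vtens_pairr b1 b2 n (u : 'cV[R[i]]_(b1 * n)) (v : 'cV[R[i]]_(b2 * n)) :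
  vtens_r (vtens_pair u v) = v.
Proof.
apply/matrixP => k j; rewrite ord1 !mxE !mxtens_indexK /= (unsplitK (inr _)).
by congr (_ _ _); rewrite -[RHS]mxtens_unindexK.
Qed.

Lemma enorm_vtens b1 b2 n (v : 'cV[R[i]]_((b1 + b2) * n)) :
  enorm v ^+ 2 = enorm (vtens_l v) ^+ 2 + enorm (vtens_r v) ^+ 2.
Proof.
rewrite !sqr_enorm !big_mxtens big_split_ord /=.
by congr (_ + _); apply: eq_bigr => i _; apply: eq_bigr => j _;
  rewrite mxE mxtens_indexK.
Qed.

Variables (a1 b1 a2 b2 n : nat) (X : 'I_g -> 'M[R[i]]_n).
Variables (d1 : 'M[freepoly R g]_(a1, b1)) (d2 : 'M[freepoly R g]_(a2, b2)).
Let d := block_mx d1 0 0 d2.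

Lemma poly_eval0 : poly_eval X (0 : freepoly R g) = 0.
Proof. by rewrite /poly_eval msupp0 big_seq_fset0. Qed.

Lemma mxpoly_eval_blockl (v : 'cV[R[i]]_((b1 + b2) * n)) :
  vtens_l (mxpoly_eval X d *m v) = mxpoly_eval X d1 *m vtens_l v.
Proof.
apply/matrixP => k c; rewrite (ord1 c); case: (mxtens_indexP k) => i j.
rewrite mxE mxtens_indexK /= !mxE !big_mxtens big_split_ord /=.
rewrite [X in _ + X]big1 ?addr0 => [|l _]; last first.
  apply: big1 => m _.
  by rewrite mxpoly_evalE block_mxEur mxE poly_eval0 mxE mul0r.
apply: eq_bigr => l _; apply: eq_bigr => m _.
by rewrite !mxpoly_evalE block_mxEul mxE mxtens_indexK.
Qed.

Lemma mxpoly_eval_blockr (v : 'cV[R[i]]_((b1 + b2) * n)) :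
  vtens_r (mxpoly_eval X d *m v) = mxpoly_eval X d2 *m vtens_r v.
Proof.
apply/matrixP => k c; rewrite (ord1 c); case: (mxtens_indexP k) => i j.
rewrite mxE mxtens_indexK /= !mxE !big_mxtens big_split_ord /=.
rewrite [X in X + _]big1 ?add0r => [|l _]; last first.
  apply: big1 => m _.
  by rewrite mxpoly_evalE block_mxEdl mxE poly_eval0 mxE mul0r.
apply: eq_bigr => l _; apply: eq_bigr => m _.
by rewrite !mxpoly_evalE block_mxEdr mxE mxtens_indexK.
Qed.

Lemma opnorm_block :
  opnorm (mxpoly_eval X d) =
  Num.max (opnorm (mxpoly_eval X d1)) (opnorm (mxpoly_eval X d2)).
Proof.
set o1 := opnorm (mxpoly_eval X d1); set o2 := opnorm (mxpoly_eval X d2).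
apply/eqP; rewrite eq_le; apply/andP; split.
  have m0 : 0 <= Num.max o1 o2 by rewrite le_max opnorm_ge0.
  apply: opnorm_le => v v1.
  rewrite -(@ler_pXn2r _ 2) ?nnegrE ?enorm_ge0 // enorm_vtens.
  rewrite mxpoly_eval_blockl mxpoly_eval_blockr.
  apply: (@le_trans _ _ (Num.max o1 o2 ^+ 2 * enorm v ^+ 2)); last first.
    by rewrite ler_piMr ?sqr_ge0 // expr_le1 ?enorm_ge0.
  rewrite enorm_vtens mulrDr -!exprMn lerD //.
    rewrite ler_pXn2r ?nnegrE ?enorm_ge0 ?mulr_ge0 ?enorm_ge0 //.
    rewrite (le_trans (enorm_mulmx_le _ _)) // ler_wpM2r ?enorm_ge0 //.
    by rewrite le_max lexx.
  rewrite ler_pXn2r ?nnegrE ?enorm_ge0 ?mulr_ge0 ?enorm_ge0 //.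
  rewrite (le_trans (enorm_mulmx_le _ _)) // ler_wpM2r ?enorm_ge0 //.
  by rewrite le_max lexx orbT.
rewrite ge_max; apply/andP; split; apply: opnorm_le => u u1.
  pose v : 'cV[R[i]]_((b1 + b2) * n) := vtens_pair u 0.
  have vE : enorm v = enorm u.
    apply/eqP; rewrite -(@eqrXn2 _ 2) ?enorm_ge0 // enorm_vtens.
    by rewrite vtens_pairl vtens_pairr enorm0 expr0n addr0.
  rewrite -vE in u1; apply: le_trans (enorm_le_opnorm1 _ u1).
  rewrite -(@ler_pXn2r _ 2) ?nnegrE ?enorm_ge0 // enorm_vtens.
  by rewrite mxpoly_eval_blockl vtens_pairl lerDl sqr_ge0.
pose v : 'cV[R[i]]_((b1 + b2) * n) := vtens_pair 0 u.
have vE : enorm v = enorm u.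
  apply/eqP; rewrite -(@eqrXn2 _ 2) ?enorm_ge0 // enorm_vtens.
  by rewrite vtens_pairl vtens_pairr enorm0 expr0n add0r.
rewrite -vE in u1; apply: le_trans (enorm_le_opnorm1 _ u1).
rewrite -(@ler_pXn2r _ 2) ?nnegrE ?enorm_ge0 // enorm_vtens.
by rewrite mxpoly_eval_blockr vtens_pairr lerDr sqr_ge0.
Qed.

End BlockDiagonal.

(* the disjoint union over n >= 1 of the g-tuples of n x n matrices *)
Record mtuple (R : realType) (g : nat) := MTuple {
  msize : nat;
  msize_gt0 : (0 < msize)%N;
  mtup :> 'I_g -> 'M[R[i]]_msize }.

Section FreeTopology.
Variables (R : realType) (g : nat).

Definition basic_free_set a b (d : 'M[freepoly R g]_(a, b)) : set (mtuple R g) :=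
  [set X : mtuple R g | opnorm (mxpoly_eval X d) < 1].

Definition basic_free_sets : set (set (mtuple R g)) :=
  [set G | exists a b (d : 'M[freepoly R g]_(a, b)), G = basic_free_set d].

Lemma basic_free_cover : \bigcup_(G in basic_free_sets) G = setT.
Proof.
apply/seteqP; split=> // X _.
exists (@basic_free_set 0 0 0); first by exists 0%N, 0%N, 0.
rewrite /basic_free_set /=; apply: le_lt_trans (ltr01).
apply: opnorm_le => v _; rewrite [X in enorm X](_ : _ = 0) ?enorm0 //.
by apply/matrixP => -[].
Qed.

Lemma basic_free_join G1 G2 X : basic_free_sets G1 -> basic_free_sets G2 ->
  G1 X -> G2 X ->
  exists G, [/\ basic_free_sets G, G X & G `<=` G1 `&` G2].
Proof.
move=> [a1 [b1 [d1 ->]]] [a2 [b2 [d2 ->]]] X1 X2.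
exists (basic_free_set (block_mx d1 0 0 d2)); split.
- by exists (a1 + a2)%N, (b1 + b2)%N, (block_mx d1 0 0 d2).
- by rewrite /basic_free_set /= opnorm_block gt_max; apply/andP; split.
- by move=> Y; rewrite /basic_free_set /= opnorm_block gt_max => /andP[].
Qed.

HB.instance Definition _ := gen_eqMixin (mtuple R g).
HB.instance Definition _ := gen_choiceMixin (mtuple R g).
HB.instance Definition _ :=
  @isBaseTopological.Build (mtuple R g) (set (mtuple R g)) basic_free_sets id
    basic_free_cover basic_free_join.

Lemma free_openP (U : set (mtuple R g)) :
  open U <-> forall X, U X -> exists a b (d : 'M[freepoly R g]_(a, b)),
    basic_free_set d X /\ basic_free_set d `<=` U.
Proof.
split=> [[D sD <-] X [G DG GX]|UP].
  have [a [b [d Gd]]] := sD _ DG; exists a, b, d.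
  by rewrite -Gd; split=> // Y GY; exists G.
exists [set G | basic_free_sets G /\ G `<=` U]; first by move=> G [].
apply/seteqP; split=> [X [G [_ GU] /GU]//|X UX].
have [a [b [d [dX dU]]]] := UP X UX.
by exists (basic_free_set d) => //; split=> //; exists a, b, d.
Qed.

Definition mdsum (X Y : mtuple R g) : mtuple R g :=
  MTuple (ltn_addr (msize Y) (msize_gt0 X)) (fun i => block_mx (X i) 0 0 (Y i)).

Definition dsum_closed (E : set (mtuple R g)) : Prop :=
  forall X Y, E X -> E Y -> E (mdsum X Y).

Definition poly_dilation_hull (X : mtuple R g) : set (mtuple R g) :=
  [set Y : mtuple R g | exists2 k : nat, (0 < k)%N & poly_dilates Y (ampliation k X)].

End FreeTopology.

(* Main.v *)
(* Y dilates to an ampliation of X if and only if every matrix-valued polynomial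
   has norm at Y at most its norm at X.  If no X in E dominated all of E in this
   sense, then each X would have a witness Y_X in E and a polynomial d_X with
   |d_X(X)| < 1 <= |d_X(Y_X)|; finitely many of the basic sets of the d_X would
   cover E, but none of them contains the direct sum of the corresponding Y_X.

   To dilate a dominated Y to an ampliation of X, look for a Kraus family
   V_1, .., V_k with w(Y) = sum_j V_j^* w(X) V_j for all words w.  Up to linear
   dependence only finitely many words matter, and the values of the right-hand
   side form the image of the cone of positive semidefinite (Gram) matrices under
   a linear map, on which the empty word controls the trace.  So the cone has a
   point nearest to the target.  If the distance is positive, the residual is a
   functional separating the target from the cone, which is the same as a
   polynomial F with Re F(X) <= 0 and Re <F(Y)e, e> > 0; then 1 + vF, suitably
   scaled with v small, contradicts domination. *)
Require Import Defs.
From mathcomp Require Import all_boot all_order all_algebra.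
From mathcomp Require Import finmap sesquilinear spectral.
From mathcomp Require Import complex mxtens monalg.
From mathcomp Require Import all_classical all_reals topology normedtype derive.
From mathcomp Require Import ring lra.

Set Implicit Arguments.
Unset Strict Implicit.
Unset Printing Implicit Defensive.

Import Order.TTheory GRing.Theory Num.Theory.
Import numFieldNormedType.Exports.

Local Open Scope classical_set_scope.
Local Open Scope ring_scope.
Local Open Scope sesquilinear_scope.

(** * Hermitian inner product and compressions by isometries *)

Section ComplexVectors.
Variable R : realType.
Local Notation C := R[i].

Lemma ReD (x y : C) : complex.Re (x + y) = complex.Re x + complex.Re y.
Proof. by case: x; case: y. Qed.

Lemma ReN (x : C) : complex.Re (- x) = - complex.Re x.
Proof. by case: x. Qed.

Lemma Re_sum (I : Type) (r : seq I) (P : pred I) (F : I -> C) :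
  complex.Re (\sum_(i <- r | P i) F i) = \sum_(i <- r | P i) complex.Re (F i).
Proof. exact: (big_morph _ ReD). Qed.

Lemma Re_realM (a : R) (x : C) : complex.Re (a%:C%C * x) = a * complex.Re x.
Proof. by case: x => b c /=; rewrite mul0r subr0. Qed.

Lemma normc_sqrE (x : C) : ComplexField.Normc.normc x ^+ 2 = complex.Re (x^* * x).
Proof.
case: x => a b /=; rewrite sqr_sqrtr ?addr_ge0 ?sqr_ge0 //.
by rewrite mulNr opprK !expr2.
Qed.

Definition cdot n (x y : 'cV[C]_n) : C := (x ^t* *m y) 0 0.

Lemma cdotE n (x y : 'cV[C]_n) : cdot x y = \sum_i (x i 0)^* * y i 0.
Proof. by rewrite /cdot !mxE; apply: eq_bigr => i _; rewrite !mxE. Qed.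

Lemma Re_cdotxx n (x : 'cV[C]_n) : complex.Re (cdot x x) = enorm x ^+ 2.
Proof.
by rewrite cdotE Re_sum sqr_enorm; apply: eq_bigr => i _; rewrite normc_sqrE.
Qed.

Lemma enorm_sqrD n (x y : 'cV[C]_n) :
  enorm (x + y) ^+ 2 = enorm x ^+ 2 + complex.Re (cdot x y) *+ 2 + enorm y ^+ 2.
Proof.
rewrite !sqr_enorm cdotE Re_sum -sumrMnl -!big_split /=.
apply: eq_bigr => i _; rewrite mxE !normc_sqrE.
case: (x i 0) => a b; case: (y i 0) => c d /=; rewrite !mulNr !opprK.
by ring.
Qed.

Lemma enorm_sqrN n (x : 'cV[C]_n) : enorm (- x) ^+ 2 = enorm x ^+ 2.
Proof. by rewrite !sqr_enorm; apply: eq_bigr => i _; rewrite mxE normcN. Qed.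

Lemma Re_cdot_le n (x y : 'cV[C]_n) :
  complex.Re (cdot x y) *+ 2 <= enorm x ^+ 2 + enorm y ^+ 2.
Proof.
have := sqr_ge0 (enorm (x - y)); rewrite enorm_sqrD enorm_sqrN.
rewrite {1}/cdot mulmxN [(- _ : 'M_1) _ _]mxE -/(cdot x y) ReN mulNrn.
by rewrite addrAC subr_ge0.
Qed.

Lemma cdot_adjoint m n (A : 'M[C]_(m, n)) (x : 'cV_m) (y : 'cV_n) :
  cdot x (A *m y) = cdot (A ^t* *m x) y.
Proof. by rewrite /cdot trmx_mul map_mxM trmxCK mulmxA. Qed.

Lemma cdot_adjointC m n (A : 'M[C]_(m, n)) (x : 'cV_n) (y : 'cV_m) :
  cdot (A *m x) y = cdot x (A ^t* *m y).
Proof. by rewrite cdot_adjoint trmxCK. Qed.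

Lemma is_isometry_adjoint m n (V : 'M[C]_(m, n)) :
  V ^t* *m V = 1%:M -> is_isometry V.
Proof.
move=> VV v; apply/eqP; rewrite -(@eqrXn2 _ 2) ?enorm_ge0 //.
by rewrite -!Re_cdotxx cdot_adjointC mulmxA VV mul1mx.
Qed.

(* AM-GM replaces Cauchy-Schwarz: with [z = U^* A V v], [|z|^2 = Re <Uz, AVv>]
   is at most half of [|Uz|^2 + |AVv|^2], and [|Uz| = |z|]. *)
Lemma opnorm_compression m n k l (U : 'M[C]_(k, m)) (A : 'M[C]_(k, l))
    (V : 'M[C]_(l, n)) :
  is_isometry U -> is_isometry V -> opnorm (U ^t* *m A *m V) <= opnorm A.
Proof.
move=> isoU isoV; apply: opnorm_le => v v1.
rewrite -!mulmxA; set z := U ^t* *m _.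
suff zle : enorm z <= enorm (A *m (V *m v)).
  by apply: le_trans zle (enorm_le_opnorm1 _ _); rewrite isoV.
have := Re_cdot_le (U *m z) (A *m (V *m v)).
have -> : cdot (U *m z) (A *m (V *m v)) = cdot z z by exact: cdot_adjointC.
rewrite Re_cdotxx (isoU z) mulr2n lerD2l.
by rewrite ler_pXn2r ?nnegrE ?enorm_ge0.
Qed.

End ComplexVectors.

(** * Evaluations at dilations, ampliations and direct sums *)

Section PolyEval.
Variables (R : realType) (g : nat).
Local Notation C := R[i].

Lemma tensmx_adjoint m n p q (A : 'M[C]_(m, n)) (B : 'M[C]_(p, q)) :
  (A *t B) ^t* = A ^t* *t B ^t*.
Proof. by apply/matrixP => i j; rewrite !mxE rmorphM. Qed.

Lemma tensmx11 m n : (1%:M : 'M[C]_m) *t (1%:M : 'M_n) = 1%:M.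
Proof.
apply/matrixP => r s; case: (mxtens_indexP r) => i j.
case: (mxtens_indexP s) => k l; rewrite tensmxE !mxE.
by rewrite (can_eq (@mxtens_indexK m n)) xpair_eqE -natrM mulnb.
Qed.

Section Tuple.
Variables (n : nat) (X : 'I_g -> 'M[C]_n).

Lemma poly_evalEw (S : {fset {fmonom 'I_g}}) (p : freepoly R g) :
  (msupp p `<=` S)%fset -> poly_eval X p = \sum_(w <- S) p@_w *: word_eval X w.
Proof.
move=> pS; apply: big_fset_incl => // w _ wp.
by rewrite mcoeff_outdom // scale0r.
Qed.

Lemma poly_evalD (p q : freepoly R g) :
  poly_eval X (p + q) = poly_eval X p + poly_eval X q.
Proof.
pose S := (msupp p `|` msupp q)%fset.
rewrite (poly_evalEw (msuppD_le p q)).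
rewrite (poly_evalEw (fsubsetUl _ _ : msupp p `<=` S)%fset).
rewrite (poly_evalEw (fsubsetUr _ _ : msupp q `<=` S)%fset).
by rewrite -big_split; apply: eq_bigr => w _; rewrite mcoeffD scalerDl.
Qed.

Lemma poly_eval_sum (I : Type) (r : seq I) (F : I -> freepoly R g) :
  poly_eval X (\sum_(i <- r) F i) = \sum_(i <- r) poly_eval X (F i).
Proof. exact: (big_morph _ poly_evalD (poly_eval0 _)). Qed.

Lemma poly_evalZ c (p : freepoly R g) : poly_eval X (c *: p) = c *: poly_eval X p.
Proof.
rewrite (poly_evalEw (msuppZ_le c p)) scaler_sumr.
by apply: eq_bigr => w _; rewrite mcoeffZ scalerA.
Qed.

Lemma poly_evalU (w : {fmonom 'I_g}) :
  poly_eval X (<< w >> : freepoly R g) = word_eval X w.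
Proof. by rewrite /poly_eval msuppU1 big_seq_fset1 mcoeffUU scale1r. Qed.

Lemma word_eval1 : word_eval X (FMonom [::]) = 1%:M.
Proof. by rewrite /word_eval big_nil. Qed.

End Tuple.

Section Dilation.
Variables (n N : nat) (Y : 'I_g -> 'M[C]_n) (X : 'I_g -> 'M[C]_N).

(** At the empty word the hypothesis reads [V^* V = 1], so [V] is an isometry; polynomials follow by
    linearity. *)
Lemma word_poly_dilates (V : 'M[C]_(N, n)) :
    (forall w, word_eval Y w = V ^t* *m word_eval X w *m V) ->
  poly_dilates Y X.
Proof.
move=> YX; exists V; first by apply: is_isometry_adjoint; rewrite -(word_eval1 Y) YX
  word_eval1 mulmx1.
move=> p; rewrite /poly_eval mulmx_sumr mulmx_suml; apply: eq_bigr => w _.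
by rewrite YX -scalemxAr -scalemxAl.
Qed.

(** The value at [Y] is the value at [X] compressed by [1 *t V] on each side, with identities of
    sizes [a] and [b]. *)
Lemma opnorm_poly_dilates a b (d : 'M[freepoly R g]_(a, b)) :
  poly_dilates Y X -> opnorm (mxpoly_eval Y d) <= opnorm (mxpoly_eval X d).
Proof.
case=> V isoV YX.
have YXw w : word_eval Y w = V ^t* *m word_eval X w *m V by rewrite -!poly_evalU.
have VV : V ^t* *m V = 1%:M.
  by rewrite -(word_eval1 Y) YXw word_eval1 mulmx1.
have iso c : is_isometry ((1%:M : 'M_c) *t V).
  apply: is_isometry_adjoint; rewrite tensmx_adjoint tensmx_mul VV trmx1 map_mx1 mulmx1.
  exact: tensmx11.
suff -> : mxpoly_eval Y d = (1%:M *t V) ^t* *m mxpoly_eval X d *m (1%:M *t V).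
  exact: opnorm_compression.
rewrite /mxpoly_eval mulmx_sumr mulmx_suml; apply: eq_bigr => w _.
by rewrite tensmx_adjoint !tensmx_mul trmx1 map_mx1 mul1mx mulmx1 YXw.
Qed.

End Dilation.

Section Ampliation.
Variables (k n : nat) (X : 'I_g -> 'M[C]_n).

Lemma word_eval_ampliation w :
  word_eval (ampliation k X) w = 1%:M *t word_eval X w.
Proof.
rewrite /word_eval; elim: (w : seq _) => [|i s IH].
  by rewrite !big_nil [RHS]tensmx11.
by rewrite !big_cons IH [LHS]tensmx_mul mulmx1.
Qed.

Lemma poly_eval_ampliation (p : freepoly R g) :
  poly_eval (ampliation k X) p = 1%:M *t poly_eval X p.
Proof.
apply/matrixP => r s; case: (mxtens_indexP r) => a b.
case: (mxtens_indexP s) => c d; rewrite tensmxE /poly_eval !summxE mulr_sumr.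
by apply: eq_bigr => w _; rewrite [LHS]mxE word_eval_ampliation tensmxE;
  rewrite [X in _ = _ * X]mxE mulrCA.
Qed.

(** The ampliation space [C^k] sits between the coefficient space [C^b] and [C^n], so a slice fixes
    the middle tensor index. *)
Definition tens_slice b (u : 'cV[C]_(b * (k * n))) (j : 'I_k) : 'cV[C]_(b * n) :=
  \col_r u (mxtens_index ((mxtens_unindex r).1,
                          mxtens_index (j, (mxtens_unindex r).2))) 0.

Lemma enorm_tens_slice b (u : 'cV[C]_(b * (k * n))) :
  enorm u ^+ 2 = \sum_j enorm (tens_slice u j) ^+ 2.
Proof.
rewrite sqr_enorm big_mxtens; under eq_bigr do rewrite big_mxtens.
rewrite exchange_big /=; apply: eq_bigr => j _; rewrite sqr_enorm big_mxtens.
by apply: eq_bigr => i _; apply: eq_bigr => l _; rewrite mxE mxtens_indexK.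
Qed.

Lemma tens_slice_ampliation a b (d : 'M[freepoly R g]_(a, b))
    (u : 'cV[C]_(b * (k * n))) j :
  tens_slice (mxpoly_eval (ampliation k X) d *m u) j =
  mxpoly_eval X d *m tens_slice u j.
Proof.
apply/matrixP => r c; rewrite (ord1 c); case: (mxtens_indexP r) => i l.
rewrite mxE mxtens_indexK /= !mxE !big_mxtens; apply: eq_bigr => i' _.
rewrite big_mxtens (bigD1 j) //= [X in _ + X]big1 ?addr0 => [|j' j'j].
  apply: eq_bigr => l' _; rewrite !mxpoly_evalE poly_eval_ampliation tensmxE.
  by rewrite !mxE eqxx mul1r mxtens_indexK.
apply: big1 => l' _; rewrite mxpoly_evalE poly_eval_ampliation tensmxE.
by rewrite mxE eq_sym (negPf j'j) !mul0r.
Qed.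

(** On every slice the ampliated value acts as [mxpoly_eval X d], and squared norms add over
    slices. *)
Lemma opnorm_ampliation_le a b (d : 'M[freepoly R g]_(a, b)) :
  opnorm (mxpoly_eval (ampliation k X) d) <= opnorm (mxpoly_eval X d).
Proof.
apply: opnorm_le => u u1; set c := opnorm _.
have c0 : 0 <= c by exact: opnorm_ge0.
apply: (@le_trans _ _ (c * enorm u)); last by rewrite ler_piMr.
rewrite -(@ler_pXn2r _ 2) ?nnegrE ?enorm_ge0 ?mulr_ge0 ?enorm_ge0 //.
rewrite exprMn !enorm_tens_slice mulr_sumr; apply: ler_sum => j _.
rewrite tens_slice_ampliation -exprMn.
by rewrite ler_pXn2r ?nnegrE ?enorm_ge0 ?mulr_ge0 ?enorm_ge0 // enorm_mulmx_le.
Qed.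

End Ampliation.

Lemma word_eval_block n m (X : 'I_g -> 'M[C]_n) (Y : 'I_g -> 'M[C]_m) w :
  word_eval (fun i => block_mx (X i) 0 0 (Y i)) w =
  block_mx (word_eval X w) 0 0 (word_eval Y w).
Proof.
rewrite /word_eval; elim: (w : seq _) => [|i s IH].
  by rewrite !big_nil [LHS]scalar_mx_block.
rewrite !big_cons IH [LHS]mulmx_block.
by rewrite !(mul0mx, mulmx0, addr0, add0r).
Qed.

Lemma poly_dilates_mdsuml (X Y : mtuple R g) : poly_dilates X (mdsum X Y).
Proof.
apply: (@word_poly_dilates _ _ _ _ (col_mx 1%:M 0)) => w.
rewrite word_eval_block -mulmxA mul_block_col tr_col_mx map_row_mx mul_row_col.
by rewrite !(mulmx1, mulmx0, mul0mx, addr0, trmx1, map_mx1, mul1mx).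
Qed.

Lemma poly_dilates_mdsumr (X Y : mtuple R g) : poly_dilates Y (mdsum X Y).
Proof.
apply: (@word_poly_dilates _ _ _ _ (col_mx 0 1%:M)) => w.
rewrite word_eval_block -mulmxA mul_block_col tr_col_mx map_row_mx mul_row_col.
by rewrite !(mulmx1, mulmx0, mul0mx, add0r, trmx1, map_mx1, mul1mx).
Qed.

End PolyEval.

(** * Gram matrices and first-order optimality *)

Section ConeSeparation.
Variable R : realType.
Local Notation C := R[i].

(** The spectral theorem gives [H = U^* d U] with [d >= 0], and [sqrt d U] is a factor. Square
    factors thus parametrise the whole positive cone, including sums, whose natural factors are
    taller stacked matrices. *)
Lemma gram_sqrt m n (A : 'M[C]_(m, n)) :
  exists W : 'M[C]_n, W ^t* *m W = A ^t* *m A.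
Proof.
set H := A ^t* *m A.
have HA : H ^t* = H by rewrite /H trmx_mul map_mxM trmxCK.
have /orthomx_spectralP HE : H \is normalmx by apply/normalmxP; rewrite HA.
set U := spectralmx H in HE *; set d := spectral_diag H in HE *.
have Uu : U \is unitarymx := spectral_unitarymx H.
have dE : diag_mx d = (A *m U ^t*) ^t* *m (A *m U ^t*).
  rewrite trmx_mul map_mxM trmxCK !mulmxA -[U *m _ *m A]mulmxA -/H.
  rewrite HE -invmx_unitary // !mulmxA mulmxV ?unitarymx_unit // mul1mx.
  by rewrite mulmxK ?unitarymx_unit.
(* Each eigenvalue is the squared norm of a column of [A U^*]. *)
have d_ge0 i : 0 <= d 0 i.
  have /matrixP/(_ i i) := dE; rewrite mxE eqxx mulr1n => ->.
  rewrite mxE sumr_ge0 // => j _.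
  by rewrite mxE [X in X^* * _]mxE mulrC mul_conjC_ge0.
exists (diag_mx (map_mx sqrtC d) *m U).
rewrite [in RHS]HE invmx_unitary // trmx_mul map_mxM -!mulmxA; congr (_ *m _).
rewrite !mulmxA; congr (_ *m _); rewrite tr_diag_mx map_diag_mx mulmx_diag.
congr diag_mx; apply/rowP => i; rewrite !mxE -[RHS]sqrtCK expr2.
by congr (_ * _); apply: geC0_conj; rewrite sqrtC_ge0.
Qed.

(** The transpose makes this the entrywise bilinear pairing, without conjugation. *)
Definition trform n (A G : 'M[C]_n) : C := \tr (A *m G^T).

Lemma trformDr n (A G H : 'M[C]_n) : trform A (G + H) = trform A G + trform A H.
Proof. by rewrite /trform linearD mulmxDr mxtraceD. Qed.

Lemma trformZr n (A G : 'M[C]_n) a : trform A (a *: G) = a * trform A G.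
Proof. by rewrite /trform linearZ -scalemxAr mxtraceZ. Qed.

Lemma trformE n (A G : 'M[C]_n) : trform A G = \sum_k \sum_l A k l * G k l.
Proof.
rewrite /trform /mxtrace; apply: eq_bigr => k _.
by rewrite mxE; apply: eq_bigr => l _; rewrite mxE.
Qed.

Lemma trform_rank1 n (A : 'M[C]_n) (x : 'cV_n) :
  trform A (x^T ^t* *m x^T) = cdot x (A *m x).
Proof.
rewrite /trform trmx_mul !trmxK mulmxA mxtrace_mulC map_trmx.
by rewrite /mxtrace big_ord1.
Qed.

(** The squared norm of [z + t w] is [|z|^2 + 2 t s + t^2 b]; a negative slope [s] would decrease it
    for small [t]. *)
Lemma Re_dot_ge0_of_min (I : finType) (z w : I -> C) :
  (forall t : R, 0 < t -> t <= 1 ->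
     \sum_i ComplexField.Normc.normc (z i) ^+ 2 <=
     \sum_i ComplexField.Normc.normc (z i + t%:C%C * w i) ^+ 2) ->
  0 <= complex.Re (\sum_i (z i)^* * w i).
Proof.
move=> zw; rewrite leNgt; apply/negP => s_lt0.
set s := complex.Re _ in s_lt0.
pose b := \sum_i ComplexField.Normc.normc (w i) ^+ 2.
have b_ge0 : 0 <= b by apply: sumr_ge0 => i _; exact: sqr_ge0.
have expand t : \sum_i ComplexField.Normc.normc (z i + t%:C%C * w i) ^+ 2 =
    \sum_i ComplexField.Normc.normc (z i) ^+ 2 + t * s *+ 2 + t ^+ 2 * b.
  rewrite /s /b Re_sum !mulr_sumr -sumrMnl -!big_split /=.
  apply: eq_bigr => i _; rewrite !normc_sqrE.
  by case: (z i) => x y; case: (w i) => x' y' /=; ring.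
(* This [t] lies in [(0, 1]] because [b >= 0], and [t b = t s - s] turns the increment into
   [t s (1 + t) < 0]. *)
pose t := - s / (b - s).
have bs : 0 < b - s by lra.
have t_gt0 : 0 < t by rewrite divr_gt0 // oppr_gt0.
have t_le1 : t <= 1 by rewrite ler_pdivrMr // mul1r; lra.
have := zw t t_gt0 t_le1; rewrite expand -addrA lerDl.
have tE : t * (b - s) = - s by rewrite divfK // gt_eqF.
rewrite mulr2n; apply/negP; rewrite -ltNge.
have -> : t * s + t * s + t ^+ 2 * b = t * (s + t * s) by nra.
by rewrite pmulr_rlt0 //; nra.
Qed.

End ConeSeparation.

(** * Continuity of complex functions through real and imaginary parts *)

Section ComplexContinuity.
Variables (R : realType) (T : topologicalType).
Local Notation C := R[i].

Definition ccontinuous (f : T -> C) :=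
  continuous (fun x => complex.Re (f x)) /\
  continuous (fun x => complex.Im (f x)).

Lemma ccontinuous_cst c : ccontinuous (fun=> c).
Proof. by split=> x; exact: cvg_cst. Qed.

Lemma ccontinuousD f h :
  ccontinuous f -> ccontinuous h -> ccontinuous (fun x => f x + h x).
Proof.
move=> [f1 f2] [h1 h2]; split=> x.
  rewrite (_ : (fun _ => _) = fun y => complex.Re (f y) + complex.Re (h y)).
    by apply: cvgD; [exact: f1|exact: h1].
  by apply/funext => y; case: (f y); case: (h y).
rewrite (_ : (fun _ => _) = fun y => complex.Im (f y) + complex.Im (h y)).
  by apply: cvgD; [exact: f2|exact: h2].
by apply/funext => y; case: (f y); case: (h y).
Qed.

Lemma ccontinuousM f h :
  ccontinuous f -> ccontinuous h -> ccontinuous (fun x => f x * h x).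
Proof.
move=> [f1 f2] [h1 h2]; split=> x.
  rewrite (_ : (fun _ => _) = fun y => complex.Re (f y) * complex.Re (h y)
      - complex.Im (f y) * complex.Im (h y)).
    by apply: cvgB; apply: cvgM; [exact: f1|exact: h1|exact: f2|exact: h2].
  by apply/funext => y; case: (f y); case: (h y).
rewrite (_ : (fun _ => _) = fun y => complex.Re (f y) * complex.Im (h y)
    + complex.Im (f y) * complex.Re (h y)).
  by apply: cvgD; apply: cvgM; [exact: f1|exact: h2|exact: f2|exact: h1].
by apply/funext => y; case: (f y); case: (h y).
Qed.

Lemma ccontinuousJ f : ccontinuous f -> ccontinuous (fun x => (f x)^*).
Proof.
move=> [f1 f2]; split=> x.
  rewrite (_ : (fun _ => _) = fun y => complex.Re (f y)); first exact: f1.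
  by apply/funext => y; case: (f y).
rewrite (_ : (fun _ => _) = fun y => - complex.Im (f y)).
  by apply: cvgN; exact: f2.
by apply/funext => y; case: (f y).
Qed.

Lemma ccontinuous_sum (I : Type) (r : seq I) (f : I -> T -> C) :
  (forall i, ccontinuous (f i)) -> ccontinuous (fun x => \sum_(i <- r) f i x).
Proof.
move=> fc; elim: r => [|i r IH].
  rewrite (_ : (fun _ => _) = fun=> 0); first exact: ccontinuous_cst.
  by apply/funext => x; rewrite big_nil.
rewrite (_ : (fun _ => _) = fun x => f i x + \sum_(j <- r) f j x).
  exact: ccontinuousD.
by apply/funext => x; rewrite big_cons.
Qed.

End ComplexContinuity.

(** * Existence of a nearest point in the image of the Gram cone *)

Section ConeDistance.
Variables (R : realType) (n : nat) (I : finType).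
Local Notation C := R[i].
Variables (T : I -> 'M[C]_n) (q : I -> C).

(** Squared distance from [q] to the image of [W^* W]; using the factor [W] as variable removes the
    positivity constraint. *)
Definition cone_dist (W : 'M[C]_n) : R :=
  \sum_i ComplexField.Normc.normc (trform (T i) (W ^t* *m W) - q i) ^+ 2.

(** Coercivity: the coordinates in [J] add up to the trace of [W^* W], which is the sum of all
    squared entries of [W]. *)
Lemma normc_le_cone_dist (J : {set I}) (W : 'M[C]_n) j k :
    \sum_(i in J) T i = 1%:M ->
  ComplexField.Normc.normc (W j k) ^+ 2 <=
    cone_dist W + \sum_i (1 + ComplexField.Normc.normc (q i)).
Proof.
move=> TJ; set G := W ^t* *m W.
have trG : \tr G = \sum_(i in J) trform (T i) G.
  by rewrite -mxtrace_tr -[G^T]mul1mx -TJ mulmx_suml raddf_sum.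
have trE : complex.Re (\tr G) =
    \sum_l \sum_i ComplexField.Normc.normc (W i l) ^+ 2.
  rewrite /mxtrace Re_sum; apply: eq_bigr => l _.
  rewrite mxE Re_sum; apply: eq_bigr => i _.
  by rewrite normc_sqrE !mxE.
apply: (@le_trans _ _ (complex.Re (\tr G))).
  rewrite trE (bigD1 k) //= (bigD1 j) //= -addrA lerDl addr_ge0 ?sumr_ge0 //.
    by move=> i _; exact: sqr_ge0.
  by move=> i _; apply: sumr_ge0 => l _; exact: sqr_ge0.
rewrite trG Re_sum -big_split /=.
apply: (@le_trans _ _ (\sum_i ComplexField.Normc.normc (trform (T i) G))).
  rewrite [leRHS](bigID (mem J)) /= -[leLHS]addr0 lerD //; last first.
    by apply: sumr_ge0 => i _; exact: normc_ge0.
  apply: ler_sum => i _; case: (trform _ _) => a b /=.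
  apply: (le_trans (ler_norm _)).
  by rewrite -sqrtr_sqr ler_wsqrtr // lerDl sqr_ge0.
apply: ler_sum => i _.
have := le_normcD (trform (T i) G - q i) (q i); rewrite subrK.
(* The linear bound becomes a quadratic one by [a <= a^2 + 1]. *)
set a := ComplexField.Normc.normc (_ - _); have := sqr_ge0 (a - 1).
have : 0 <= a by exact: normc_ge0.
by set b := ComplexField.Normc.normc (q i); nra.
Qed.

(** By coercivity only a compact box of factors competes with [W = 0], and the extreme value theorem
    applies there. *)
Lemma cone_dist_min (J : {set I}) : \sum_(i in J) T i = 1%:M ->
  exists W, forall W', cone_dist W <= cone_dist W'.
Proof.
move=> TJ.
pose mk (x : 'rV[R]_(n * n + n * n)) : 'M[C]_n :=
  \matrix_(k, l) (x 0 (lshift _ (mxvec_index k l)) +i*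
                  x 0 (rshift _ (mxvec_index k l)))%C.
(* A factor no worse than 0 has squared entries at most [M - 1], hence entries at most [M]. *)
pose M := 1 + cone_dist 0 + \sum_i (1 + ComplexField.Normc.normc (q i)).
pose A := [set x : 'rV[R]_(n * n + n * n) | forall i, x 0 i \in `[- M, M]].
have M_ge1 : 1 <= M.
  rewrite /M -addrA lerDl addr_ge0 ?sumr_ge0 // => i _; first exact: sqr_ge0.
  by rewrite addr_ge0 ?normc_ge0.
have cptA : compact A.
  have := @rV_compact R _ (fun=> `[- M, M]%classic)
    (fun=> @segment_compact R _ _).
  exact.
have A0 : A 0 by move=> i; rewrite mxE in_itv /= oppr_le0 (le_trans ler01 M_ge1).
have entry k l : ccontinuous (fun x => mk x k l).
  split; (under boolp.eq_fun do rewrite mxE); exact: coord_continuous.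
have cont : continuous (cone_dist \o mk).
  pose h i x := trform (T i) (mk x ^t* *m mk x) - q i.
  have hc i : ccontinuous (h i).
    apply: ccontinuousD; last exact: ccontinuous_cst.
    rewrite (_ : (fun _ => _) = fun x => \sum_k \sum_l T i k l *
        \sum_j (mk x j k)^* * mk x j l).
      do 2![apply: ccontinuous_sum => ?]; apply: ccontinuousM.
        exact: ccontinuous_cst.
      by apply: ccontinuous_sum => j; apply: ccontinuousM => //;
        exact: ccontinuousJ.
    apply/funext => x; rewrite trformE; apply: eq_bigr => k _.
    apply: eq_bigr => l _; rewrite mxE; congr (_ * _).
    by apply: eq_bigr => j _; rewrite mxE [X in X^* * _]mxE.
  have [hc2 _] : ccontinuous (fun x => \sum_i (h i x)^* * h i x).
    apply: ccontinuous_sum => i; apply: ccontinuousM => //.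
    exact: ccontinuousJ.
  rewrite (_ : _ \o _ = fun x => complex.Re (\sum_i (h i x)^* * h i x)) //.
  apply/funext => x; rewrite Re_sum.
  by apply: eq_bigr => i _; rewrite normc_sqrE.
have [x _ xmin] := compact_EVT_min (ex_intro _ _ A0) cptA
  (continuous_subspaceT cont).
exists (mk x) => W.
have dist0 : cone_dist (mk x) <= cone_dist 0.
  have -> : 0 = mk 0 by apply/matrixP => k l; rewrite !mxE.
  exact/xmin/mem_set.
(* A factor worse than 0 is already beaten through [dist0]; any other one lies in the box. *)
have [/ltW|W0] := ltP (cone_dist 0) (cone_dist W); first exact: le_trans.
pose y : 'rV_(n * n + n * n) := row_mx (mxvec (map_mx (@complex.Re R) W))
  (mxvec (map_mx (@complex.Im R) W)).
have -> : W = mk y.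
  apply/matrixP => k l; rewrite mxE row_mxEl row_mxEr !mxvecE !mxE.
  by case: (W k l).
apply: xmin; apply: mem_set.
have Wle k l : ComplexField.Normc.normc (W k l) <= M.
  have := normc_le_cone_dist W k l TJ.
  have : 0 <= ComplexField.Normc.normc (W k l) by exact: normc_ge0.
  rewrite /M; nra.
have ReM (c : C) : ComplexField.Normc.normc c <= M ->
    (complex.Re c \in `[- M, M]) /\ (complex.Im c \in `[- M, M]).
  case: c => a b cM; rewrite !in_itv /= -!ler_norml; split.
    by apply: le_trans cM; rewrite /= -sqrtr_sqr ler_wsqrtr // lerDl sqr_ge0.
  by apply: le_trans cM; rewrite /= -sqrtr_sqr ler_wsqrtr // lerDr sqr_ge0.
move=> i; rewrite -(splitK i); case: (fintype.split i) => j.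
  rewrite /= row_mxEl; case/mxvec_indexP: j => k l; rewrite mxvecE mxE.
  by have [] := ReM _ (Wle k l).
rewrite /= row_mxEr; case/mxvec_indexP: j => k l; rewrite mxvecE mxE.
by have [] := ReM _ (Wle k l).
Qed.

End ConeDistance.

(** * Separating a point from the image of the Gram cone *)

Section Separation.
Variables (R : realType) (n : nat) (I : finType).
Local Notation C := R[i].
Variables (T : I -> 'M[C]_n) (q : I -> C).

Lemma adjoint_scale_real m (c : R) (W : 'M[C]_(m, n)) :
  (c%:C%C *: W) ^t* = c%:C%C *: W ^t*.
Proof.
rewrite linearZ /= map_mxZ; congr (_ *: _).
by apply/eqP; rewrite eq_complex /= oppr0 !eqxx.
Qed.

(** Optimality is tested in two directions: adding a rank-one ray bounds the functional on the cone,
    and shrinking towards the apex makes it positive at [q]. *)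
Lemma cone_separation (J : {set I}) : \sum_(i in J) T i = 1%:M ->
  (exists W : 'M[C]_n, forall i, trform (T i) (W ^t* *m W) = q i) \/
  (exists D : I -> C,
    (forall x : 'cV_n, complex.Re (\sum_i (D i)^* * cdot x (T i *m x)) <= 0) /\
    0 < complex.Re (\sum_i (D i)^* * q i)).
Proof.
move=> TJ; have [W Wmin] := cone_dist_min q TJ.
pose z i := trform (T i) (W ^t* *m W) - q i.
have [z0|z0] := pselect (forall i, z i = 0).
  by left; exists W => i; apply/eqP; rewrite -subr_eq0; apply/eqP/z0.
right; exists (fun i => - z i).
have scale_gram m (t : R) (A : 'M[C]_(m, n)) : 0 <= t ->
    ((Num.sqrt t)%:C%C *: A) ^t* *m ((Num.sqrt t)%:C%C *: A) =
    t%:C%C *: (A ^t* *m A).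
  move=> t0; rewrite adjoint_scale_real -scalemxAl -scalemxAr scalerA.
  by rewrite -rmorphM /= -expr2 sqr_sqrtr.
(* Appending the row [sqrt t x^T] to [W] adds [t] times a rank-one Gram matrix; [gram_sqrt] makes
   the factor square again. *)
have add_ray x : 0 <= complex.Re (\sum_i (z i)^* * cdot x (T i *m x)).
  apply: Re_dot_ge0_of_min => t t0 _.
  have [W' W'E] := gram_sqrt (col_mx W ((Num.sqrt t)%:C%C *: x^T)).
  apply: le_trans (Wmin W') _; rewrite /cone_dist W'E.
  rewrite tr_col_mx map_row_mx mul_row_col (scale_gram _ _ _ (ltW t0)).
  by apply: ler_sum => i _; rewrite trformDr trformZr trform_rank1 addrAC.
have shrink : 0 <= complex.Re (\sum_i (z i)^* * - trform (T i) (W ^t* *m W)).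
  apply: Re_dot_ge0_of_min => t t0 t1.
  apply: le_trans (Wmin ((Num.sqrt (1 - t))%:C%C *: W)) _; rewrite /cone_dist.
  rewrite scale_gram ?subr_ge0 //; apply: ler_sum => i _.
  rewrite trformZr le_eqVlt; apply/orP; left; apply/eqP; congr (_ _ ^+ 2).
  by rewrite /z rmorphB rmorph1 /=; ring.
split=> [x|].
  rewrite (eq_bigr (fun i => - ((z i)^* * cdot x (T i *m x)))) => [|i _].
    by rewrite sumrN ReN oppr_le0.
  by rewrite rmorphN mulNr.
(* With [p] the nearest point, [q = p - z], so the pairing is the [shrink] term plus [|z|^2]. *)
have -> : \sum_i (- z i)^* * q i =
    \sum_i (z i)^* * - trform (T i) (W ^t* *m W) + \sum_i (z i)^* * z i.
  rewrite -big_split; apply: eq_bigr => i _ /=.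
  by rewrite rmorphN /z; ring.
rewrite ReD ltr_wpDl // Re_sum lt_def sumr_ge0 ?andbT => [|i _]; last first.
  by rewrite -normc_sqrE sqr_ge0.
apply/negP => /eqP/psumr_eq0P zz; apply: z0 => i.
apply: ComplexField.Normc.eq0_normc; apply/eqP.
rewrite -sqrf_eq0 normc_sqrE zz // => j _.
by rewrite -normc_sqrE sqr_ge0.
Qed.

End Separation.

(** * Norm separation by affine combinations, and Kraus operators *)

Section Dominated.
Variable R : realType.
Local Notation C := R[i].

Lemma sqr_normc_real (a : R) : ComplexField.Normc.normc a%:C%C ^+ 2 = a ^+ 2.
Proof. by rewrite /= expr0n addr0 sqr_sqrtr ?sqr_ge0. Qed.

(* If [Re A <= 0] then [|u + vA|^2 <= u^2 + v^2 |A|^2], with no term linear in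
   [v]; for [B], with [eps = Re <Be, e> / |e|^2], [|u + vB| >= u + v eps].  Taking
   [u = 1 - v eps] makes the latter 1, and the chosen [v] makes the former
   [u^2 + v^2 |A|^2 = u < 1]. *)
Lemma opnorm_separation m p (A : 'M[C]_m) (B : 'M[C]_p) (e : 'cV[C]_p) :
    (forall x, complex.Re (cdot x (A *m x)) <= 0) ->
    0 < complex.Re (cdot e (B *m e)) ->
  exists u v : R, opnorm (u%:C%C *: 1%:M + v%:C%C *: A) < 1 /\
                  1 <= opnorm (u%:C%C *: 1%:M + v%:C%C *: B).
Proof.
move=> A_le0 B_gt0; set b := complex.Re _ in B_gt0; set c := opnorm A.
have c_ge0 : 0 <= c by exact: opnorm_ge0.
have expand k (H : 'M[C]_k) (x y : 'cV[C]_k) (u v : R) :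
    complex.Re (cdot x ((u%:C%C *: 1%:M + v%:C%C *: H) *m y)) =
    u * complex.Re (cdot x y) + v * complex.Re (cdot x (H *m y)).
  rewrite mulmxDl -!scalemxAl mul1mx /cdot mulmxDr -!scalemxAr.
  by rewrite ![((_ : 'M_1) + _) _ _]mxE ![(_ *: (_ : 'M_1)) _ _]mxE ReD !Re_realM.
have e_gt0 : 0 < enorm e.
  rewrite lt_def enorm_ge0 andbT; apply: contraTneq B_gt0 => /enorm_eq0 e0.
  by rewrite /b e0 mulmx0 /cdot mulmx0 mxE ltxx.
pose E := enorm e ^+ 2; have E_gt0 : 0 < E by rewrite exprn_gt0.
pose eps := b / E; have eps_gt0 : 0 < eps by rewrite divr_gt0.
have bE : b = eps * E by rewrite divfK ?gt_eqF.
have den_gt0 : 0 < eps ^+ 2 + c ^+ 2 by rewrite ltr_wpDr ?sqr_ge0 ?exprn_gt0.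
(* The minimiser of [(1 - v eps)^2 + v^2 c^2]. *)
pose v := eps / (eps ^+ 2 + c ^+ 2).
have v_gt0 : 0 < v by rewrite divr_gt0.
have vden : v * (eps ^+ 2 + c ^+ 2) = eps by rewrite divfK ?gt_eqF.
pose u := 1 - v * eps.
have u_ge0 : 0 <= u by have := sqr_ge0 c; rewrite /u; nra.
have u_lt1 : u < 1 by rewrite /u ltrBlDr ltrDl mulr_gt0.
exists u, v; split.
  apply: (@le_lt_trans _ _ (Num.sqrt u)); last first.
    by rewrite -[ltRHS]sqrtr1 ltr_sqrt.
  apply: opnorm_le => x x1.
  rewrite -(@ler_pXn2r _ 2) ?nnegrE ?enorm_ge0 ?sqrtr_ge0 // [leRHS]sqr_sqrtr //.
  have x2 : enorm x ^+ 2 <= 1 by rewrite expr_le1 ?enorm_ge0.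
  have Ax2 : enorm (A *m x) ^+ 2 <= c ^+ 2.
    by rewrite ler_pXn2r ?nnegrE ?enorm_ge0 // enorm_le_opnorm1.
  rewrite mulmxDl -!scalemxAl mul1mx enorm_sqrD !enormZ !exprMn !sqr_normc_real.
  have -> : complex.Re (cdot (u%:C%C *: x) (v%:C%C *: (A *m x))) =
      u * v * complex.Re (cdot x (A *m x)).
    rewrite !cdotE !Re_sum mulr_sumr; apply: eq_bigr => i _; rewrite !mxE.
    by case: (x i 0) => ? ?; case: (\sum_j _) => ? ? /=; ring.
  have := A_le0 x; set r := complex.Re _ => r_le0.
  have uvr : u * v * r <= 0 by rewrite mulr_ge0_le0 // mulr_ge0 // ltW.
  have h1 : u ^+ 2 * enorm x ^+ 2 <= u ^+ 2 by rewrite ler_piMr ?sqr_ge0.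
  have h2 : v ^+ 2 * enorm (A *m x) ^+ 2 <= v ^+ 2 * c ^+ 2.
    by rewrite ler_wpM2l ?sqr_ge0.
  have h3 : u ^+ 2 + v ^+ 2 * c ^+ 2 = u.
    by rewrite {1}/u; have := congr1 (fun y => v * y) vden; rewrite /u /=; nra.
  by lra.
set M := _ + _; rewrite -(@ler_pM2r _ (enorm e)) // mul1r.
apply: le_trans (enorm_mulmx_le _ _).
rewrite -(@ler_pXn2r _ 2) ?nnegrE ?enorm_ge0 //.
(* Since [u + v eps = 1], [Re <e, M e> = |e|^2], and AM-GM yields [|e| <= |M e|]. *)
have := Re_cdot_le e (M *m e); rewrite expand Re_cdotxx -/b -/E bE.
by rewrite /u; nra.
Qed.

(* Row j of W, reshaped as an N x n matrix, is the j-th Kraus operator; the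
   operators are stacked on top of each other. *)
Definition kraus k n N (W : 'M[C]_(k, n * N)) : 'M[C]_(k * N, n) :=
  \matrix_(r, a) W (mxtens_unindex r).1 (mxtens_index (a, (mxtens_unindex r).2)).

(** Both sides expand to the sum over [j, c, d] of [conj W_j(a,c) P_cd W_j(b,d)]. Entries of a Kraus
    sum are therefore linear in the Gram matrix of [W]. *)
Lemma krausE k n N (W : 'M[C]_(k, n * N)) (P : 'M[C]_N) a b :
  ((kraus W) ^t* *m (1%:M *t P) *m kraus W) a b =
  trform (delta_mx a b *t P) (W ^t* *m W).
Proof.
rewrite trformE big_mxtens (bigD1 a) //= [X in _ + X]big1 ?addr0; last first.
  move=> i ia; apply: big1 => c _; apply: big1 => r _.
  case: (mxtens_indexP r) => j d.
  by rewrite tensmxE [delta_mx _ _ _ _]mxE (negPf ia) !mul0r.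
transitivity (\sum_c \sum_d P c d * (W ^t* *m W) (mxtens_index (a, c))
    (mxtens_index (b, d))); last first.
  apply: eq_bigr => c _; rewrite big_mxtens (bigD1 b) //= [X in _ + X]big1 ?addr0.
    by apply: eq_bigr => d _; rewrite tensmxE [delta_mx _ _ _ _]mxE !eqxx mul1r.
  move=> i ib; apply: big1 => d _.
  by rewrite tensmxE [delta_mx _ _ _ _]mxE (negPf ib) andbF !mul0r.
rewrite mxE big_mxtens exchange_big [RHS]exchange_big /=; apply: eq_bigr => d _.
transitivity (\sum_j \sum_c (W j (mxtens_index (a, c)))^* * P c d *
    W j (mxtens_index (b, d))).
  apply: eq_bigr => j _; rewrite mxE big_mxtens mulr_suml.
  rewrite (bigD1 j) //= [X in _ + X]big1 ?addr0 => [|j' j'j].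
    rewrite mulr_suml; apply: eq_bigr => c _.
    by rewrite tensmxE !mxE !mxtens_indexK /= ?eqxx mul1r.
  rewrite big1 ?mul0r // => c _.
  by rewrite tensmxE [_%:M _ _]mxE (negPf j'j) mul0r mulr0.
rewrite exchange_big; apply: eq_bigr => c _; rewrite mxE mulr_sumr.
by apply: eq_bigr => j _; rewrite !mxE mulrA [P c d * _]mulrC.
Qed.

End Dominated.

(** * Dilating a dominated tuple to an ampliation *)

Section DominatedDilation.
Variables (R : realType) (g : nat).
Local Notation C := R[i].

(** Choose words whose values span a subspace of maximal dimension; one more word cannot enlarge
    it. *)
Lemma word_span n (Z : 'I_g -> 'M[C]_n) :
  exists ws : seq {fmonom 'I_g}, forall w, exists c : 'I_(size ws) -> C,
    word_eval Z w = \sum_i c i *: word_eval Z (nth (FMonom [::]) ws i).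
Proof.
pose f ws := <<[seq word_eval Z v | v <- ws]>>%VS.
pose P k := `[< exists ws, \dim (f ws) = k >].
have exP : exists k, P k by exists (\dim (f [::])); apply/asboolP; exists [::].
have leP k : P k -> (k <= \dim (fullv : {vspace 'M[C]_n}))%N.
  by move/asboolP => [ws <-]; exact/dimvS/subvf.
case: (ex_maxnP exP leP) => k /asboolP[ws wsk] kmax; exists ws => w.
have fw : (f ws <= f (w :: ws))%VS.
  by apply: sub_span => v vs; rewrite inE vs orbT.
have /eqP fE : f ws == f (w :: ws).
  by rewrite eqEdim fw wsk /=; apply: kmax; apply/asboolP; exists (w :: ws).
have : word_eval Z w \in f ws by rewrite fE memv_span // inE eqxx.
pose t := map_tuple (word_eval Z) (in_tuple ws).
rewrite /f (_ : map _ _ = t) // => /coord_span ->.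
exists (coord t ^~ (word_eval Z w)); apply: eq_bigr => i _; congr (_ *: _).
by rewrite -[RHS](nth_map _ 0 (word_eval Z)).
Qed.

Lemma tensmx_sumZr (I : finType) m n p q (A : 'M[C]_(m, n)) (c : I -> C)
    (M : I -> 'M[C]_(p, q)) :
  A *t (\sum_i c i *: M i) = \sum_i c i *: (A *t M i).
Proof.
apply/matrixP => r s; rewrite mxE !summxE mulr_sumr; apply: eq_bigr => i _.
by rewrite !mxE mulrCA.
Qed.

(** The multiplicity [n * N] is the number of rows of the square factor [W], one Kraus operator per
    row. *)
Lemma opnorm_dominated_dilates n N (X : 'I_g -> 'M[C]_N) (Y : 'I_g -> 'M[C]_n) :
    (forall a (d : 'M[freepoly R g]_a),
      opnorm (mxpoly_eval X d) < 1 -> opnorm (mxpoly_eval Y d) < 1) ->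
  poly_dilates Y (ampliation (n * N) X).
Proof.
(* Relations between words at the direct sum hold at [X] and [Y] with the same coefficients. *)
move=> XY; pose Z i := block_mx (X i) 0 0 (Y i).
have [ws0 wsP] := word_span Z; pose r := size ws0.
(* The empty word is put at index 0: its diagonal entries form [J], and the corresponding [T] sum to
   the identity. *)
pose ws (s : 'I_r.+1) := nth (FMonom [::]) (FMonom [::] :: ws0) s.
pose I : finType := ('I_r.+1 * ('I_n * 'I_n))%type.
pose T (i : I) : 'M[C]_(n * N) := delta_mx i.2.1 i.2.2 *t word_eval X (ws i.1).
pose q (i : I) : C := word_eval Y (ws i.1) i.2.1 i.2.2.
pose J : {set I} := [set i : I | (i.1 == ord0) && (i.2.1 == i.2.2)]%SET.
have TJ : \sum_(i in J) T i = 1%:M.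
  rewrite -(tensmx11 R n N); apply/matrixP => x y.
  case: (mxtens_indexP x) => a c; case: (mxtens_indexP y) => b d.
  rewrite summxE (bigD1 (ord0, (a, a))) ?inE ?eqxx //= big1 => [|[s [a' b']]].
    by rewrite addr0 !tensmxE word_eval1 !mxE eqxx /= [b == a]eq_sym.
  rewrite inE /= => /andP[/andP[/eqP -> /eqP <-] a'a].
  rewrite tensmxE [delta_mx _ _ _ _]mxE (_ : (a == a') = false) ?mul0r //.
  by apply: contraNF a'a => /eqP ->.
have [[W WE]|[D [D_le0 D_gt0]]] := cone_separation q TJ.
  have wsE s : word_eval Y (ws s) =
      (kraus W) ^t* *m (1%:M *t word_eval X (ws s)) *m kraus W.
    by apply/matrixP => a b; rewrite krausE; exact/esym/(WE (s, (a, b))).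
  apply: (@word_poly_dilates _ _ _ _ _ _ (kraus W)) => w.
  have [c] := wsP w; under eq_bigr do rewrite word_eval_block.
  rewrite word_eval_block => cE.
  have XE : word_eval X w = \sum_(i < r) c i *: word_eval X (ws (lift ord0 i)).
    apply/matrixP => a b; have /matrixP/(_ (lshift n a) (lshift n b)) := cE.
    rewrite block_mxEul !summxE => ->; apply: eq_bigr => i _.
    by rewrite [LHS]mxE block_mxEul [RHS]mxE.
  have YE : word_eval Y w = \sum_(i < r) c i *: word_eval Y (ws (lift ord0 i)).
    apply/matrixP => a b; have /matrixP/(_ (rshift N a) (rshift N b)) := cE.
    rewrite block_mxEdr !summxE => ->; apply: eq_bigr => i _.
    by rewrite [LHS]mxE block_mxEdr [RHS]mxE.
  rewrite word_eval_ampliation XE YE tensmx_sumZr mulmx_sumr mulmx_suml.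
  by apply: eq_bigr => i _; rewrite wsE -scalemxAr -scalemxAl.
(* The separating functional read as a polynomial: its value at [X] is the sum of the
   [(D i)^* *: T i]. *)
pose F : 'M[freepoly R g]_n := \matrix_(a, b)
  \sum_s (D (s, (a, b)))^* *: << ws s >>.
have FE m (S : 'I_g -> 'M[C]_m) a b :
    poly_eval S (F a b) = \sum_s (D (s, (a, b)))^* *: word_eval S (ws s).
  rewrite mxE poly_eval_sum; apply: eq_bigr => s _.
  by rewrite poly_evalZ poly_evalU.
have XF : mxpoly_eval X F = \sum_i (D i)^* *: T i.
  apply/matrixP => x y.
  case: (mxtens_indexP x) => a c; case: (mxtens_indexP y) => b d.
  rewrite mxpoly_evalE FE !summxE.
  transitivity (\sum_s \sum_ab ((D (s, ab))^* *: T (s, ab))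
      (mxtens_index (a, c)) (mxtens_index (b, d))); last first.
    by rewrite pair_bigA; apply: eq_bigr => -[s ab].
  apply: eq_bigr => s _; rewrite (bigD1 (a, b)) //= big1 => [|[a' b'] ab].
    by rewrite addr0 [LHS]mxE [RHS]mxE tensmxE [delta_mx _ _ _ _]mxE !eqxx mul1r.
  rewrite mxE tensmxE [delta_mx _ _ _ _]mxE -xpair_eqE eq_sym (negPf ab).
  by rewrite mul0r mulr0.
(* The unnormalised maximally entangled vector: [<e, (delta_mx a b *t B) e>] is the entry [B a b],
   so [e] reads off the targets [q]. *)
pose e : 'cV[C]_(n * n) :=
  \col_x ((mxtens_unindex x).1 == (mxtens_unindex x).2)%:R.
have YF : cdot e (mxpoly_eval Y F *m e) = \sum_i (D i)^* * q i.
  have eE a c : e (mxtens_index (a, c)) 0 = (a == c)%:R.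
    by rewrite mxE mxtens_indexK.
  rewrite cdotE big_mxtens.
  transitivity (\sum_a \sum_b \sum_s (D (s, (a, b)))^* * q (s, (a, b))).
    apply: eq_bigr => a _; rewrite (bigD1 a) //= big1 => [|c ca]; last first.
      by rewrite eE eq_sym (negPf ca) rmorph0 mul0r.
    rewrite addr0 eE eqxx rmorph1 mul1r mxE big_mxtens; apply: eq_bigr => b _.
    rewrite (bigD1 b) //= big1 => [|d db]; last first.
      by rewrite eE eq_sym (negPf db) mulr0.
    rewrite addr0 eE eqxx mulr1 mxpoly_evalE FE summxE.
    by apply: eq_bigr => s _; rewrite mxE.
  rewrite pair_bigA exchange_big /= pair_bigA /=.
  by apply: eq_bigr => -[s [a b]].
(* Adding [u] times the empty word on the diagonal realises [u 1 + v F] as a matrix polynomial. *)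
pose G u v : 'M[freepoly R g]_n :=
  \matrix_(a, b) ((u *+ (a == b)) *: << FMonom [::] >> + v *: F a b).
have GE m (S : 'I_g -> 'M[C]_m) u v :
    mxpoly_eval S (G u v) = u *: 1%:M + v *: mxpoly_eval S F.
  rewrite -tensmx11; apply/matrixP => x y.
  case: (mxtens_indexP x) => a c; case: (mxtens_indexP y) => b d.
  rewrite mxpoly_evalE mxE poly_evalD !poly_evalZ poly_evalU word_eval1.
  rewrite [LHS]mxE [RHS]mxE; congr (_ + _); last first.
    by rewrite !mxE mxpoly_evalE mxE.
  by rewrite [RHS]mxE tensmxE !mxE mulrA -[u *+ _]mulr_natr.
have X_le0 x : complex.Re (cdot x (mxpoly_eval X F *m x)) <= 0.
  have := D_le0 x; congr (complex.Re _ <= 0).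
  rewrite XF mulmx_suml /cdot mulmx_sumr summxE; apply: eq_bigr => i _.
  by rewrite -scalemxAl -scalemxAr [RHS]mxE.
rewrite -YF in D_gt0.
have [u [v [Xlt1 Yge1]]] := opnorm_separation X_le0 D_gt0.
by have := XY _ (G u%:C%C v%:C%C); rewrite !GE => /(_ Xlt1); rewrite ltNge Yge1.
Qed.

End DominatedDilation.

(** * From compactness to a dominating element *)

Section Compactness.
Variables (R : realType) (g : nat).

Lemma opnorm_dilation_hull (X Y : mtuple R g) a b (d : 'M[freepoly R g]_(a, b)) :
  poly_dilation_hull X Y -> opnorm (mxpoly_eval Y d) <= opnorm (mxpoly_eval X d).
Proof.
case=> k _ YX; apply: le_trans (opnorm_ampliation_le k X d).
exact: opnorm_poly_dilates.
Qed.

(** Each summand dilates to the direct sum, so summing the list only increases norms; nonemptiness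
    of [E] handles the empty list. *)
Lemma dsum_closed_upper_bound (E : set (mtuple R g)) (s : seq (mtuple R g)) :
    E !=set0 -> dsum_closed E -> (forall Y, Y \in s -> E Y) ->
  exists2 Z, E Z & forall Y, Y \in s -> forall a (d : 'M[freepoly R g]_a),
    opnorm (mxpoly_eval Y d) <= opnorm (mxpoly_eval Z d).
Proof.
move=> E0 Edsum; elim: s => [_|Y s IH Es]; first by case: E0 => Z EZ; exists Z.
have [|Z EZ sZ] := IH; first by move=> W Ws; apply: Es; rewrite inE Ws orbT.
exists (mdsum Y Z); first by apply: Edsum => //; apply: Es; rewrite inE eqxx.
move=> W; rewrite inE => /orP[/eqP -> a d|/sZ WZ a d].
  exact/opnorm_poly_dilates/poly_dilates_mdsuml.
exact/(le_trans (WZ a d))/opnorm_poly_dilates/poly_dilates_mdsumr.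
Qed.

Lemma cover_compact_dominating (E : set (mtuple R g)) :
    E !=set0 -> dsum_closed E -> cover_compact E ->
  exists2 X, E X & forall Y, E Y -> forall a (d : 'M[freepoly R g]_a),
    opnorm (mxpoly_eval X d) < 1 -> opnorm (mxpoly_eval Y d) < 1.
Proof.
move=> E0 Edsum Ecompact; apply: contrapT => noX.
(* The premise [E X] stands inside the existential so that choice gives a function on all tuples;
   outside [E] its value is a dummy. *)
have sep (X : mtuple R g) : exists Yd : mtuple R g * {a & 'M[freepoly R g]_a},
    E X -> [/\ E Yd.1, basic_free_set (projT2 Yd.2) X
             & ~ basic_free_set (projT2 Yd.2) Yd.1].
  apply: contrapT => /forallNP noYd; apply: noX; exists X.
    apply: contrapT => EX.
    by apply: (noYd (X, existT (fun a => 'M[freepoly R g]_a) 0%N 0)) => /EX.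
  move=> Y EY a d Xd; apply: contrapT => Yd.
  by apply: (noYd (Y, existT (fun a => 'M[freepoly R g]_a) a d)).
have [Yd YdP] := choice sep.
pose U X := basic_free_set (projT2 (Yd X).2).
have [X _|X EX|D DE Dcover] := Ecompact _ E U.
- apply/free_openP => Y UY; exists _, _, (projT2 (Yd X).2).
  by split.
- by exists X => //; case: (YdP X EX).
have [|Z EZ DZ] := @dsum_closed_upper_bound E [seq (Yd X).1 | X <- D] E0 Edsum.
  by move=> _ /mapP[X /DE/set_mem EX ->]; case: (YdP X EX).
(* [Z] lies in some [U X], and domination by [Z] forces the witness of [X] into it too. *)
have [X /= XD ZX] := Dcover _ EZ; have EX := set_mem (DE _ XD).
case: (YdP X EX) => _ _; apply; apply: le_lt_trans ZX.
by apply: DZ; apply/mapP; exists X.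
Qed.

End Compactness.

Theorem theorem1p1 (R : realType) (g : nat) (g_gt0 : (0 < g)%N)
    (E : set (mtuple R g)) (E_neq0 : E !=set0) (E_dsum : dsum_closed E) :
  cover_compact E <->
  exists X : mtuple R g, E X /\ E `<=` poly_dilation_hull X.
Proof.
split=> [Ecompact|[X [EX EhullX]] I D U Uopen Ecover].
  have [X EX XE] := cover_compact_dominating E_neq0 E_dsum Ecompact.
  exists X; split=> // Y EY; exists (Defs.msize Y * Defs.msize X)%N.
    by rewrite muln_gt0 !msize_gt0.
  exact/opnorm_dominated_dilates/XE.
(* A single member suffices: norms on the hull are bounded by those at [X], so a basic neighbourhood
   of [X] contains all of [E]. *)
have [i Di UiX] := Ecover X EX.
have [a [b [d [dX dU]]]] := (free_openP (U i)).1 (Uopen i Di) X UiX.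
exists [fset i]%fset => [j|Y EY].
  by rewrite in_fset1 => /eqP ->; exact: mem_set.
exists i; first by rewrite /= inE.
apply: dU; apply: le_lt_trans dX; exact/opnorm_dilation_hull/EhullX.
Qed.
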